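(* Let $n \ge 0$ and $k \ge 2$ be integers, let $H_n=\{0,1\}^n$, and let $\mu$ be a UI measure on $H_n$. Suppose $$H_n = A \sqcup C_1 \sqcup C_2 \sqcup \dots \sqcup C_k \sqcup B$$ is a partition of $H_n$ into pairwise disjoint (possibly empty) subsets such that for every $i\in\{1,\dots,k\}$ the set $A \cup C_i$ is closed upwards. Then $$\mu(A)\,\mu(B) \ \ge\ e_2\big(\mu(C_1), \dots, \mu(C_k)\big).$$
   Context: $H_n=\{0,1\}^n$ is the $n$-dimensional discrete hypercube with the coordinatewise partial order. A subset of $H_n$ is closed upwards if together with each vector $v$ it contains every $w \in H_n$ with $w \ge v$ coordinatewise. The second elementary symmetric polynomial is $e_2(x_1,\dots,x_k)=\sum_{1\le i<j\le k}x_ix_j$. A probability measure $\mu$ on $H_n$ is called FUI (finitely many underlying independents) if there exist some $m$, independent (not necessarily identically distributed) Bernoulli ($\{0,1\}$-valued) random variables $Y_1,\dots,Y_m$, and coordinatewise non-decreasing functions $f_1,\dots,f_n:\{0,1\}^m\to\{0,1\}$ such that $\mu$ is the joint law of $(X_1,\dots,X_n)$, where $X_i=f_i(Y_1,\dots,Y_m)$. A probability measure on $H_n$ is called UI if it is a limit of a sequence of FUI measures on the same hypercube $H_n$ (i.e. pointwise convergence of the probabilities of each element of the finite set $H_n$). *)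

(* Defs.v *)
From HB Require Import structures.
From mathcomp Require Import all_boot all_order all_algebra.
From mathcomp Require Import all_classical all_reals all_analysis.

Set Implicit Arguments.
Unset Strict Implicit.
Unset Printing Implicit Defensive.

Import Order.TTheory GRing.Theory Num.Theory.
Import numFieldNormedType.Exports.

Local Open Scope classical_set_scope.
Local Open Scope ring_scope.

Definition hypercube (n : nat) : Type := {ffun 'I_n -> bool}.

HB.instance Definition _ (n : nat) := Finite.on (hypercube n).
HB.instance Definition _ (n : nat) :=
  isPointed.Build (hypercube n) [ffun=> false].
HB.instance Definition _ (n : nat) :=
  @isMeasurable.Build default_measure_display (hypercube n)
    discrete_measurable discrete_measurable0
    discrete_measurableC discrete_measurableU.

Definition leH (n : nat) (v w : hypercube n) : Prop :=
  forall i, (v i <= w i)%O.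

Definition closed_upwards (n : nat) (S : set (hypercube n)) : Prop :=
  forall v w, S v -> leH v w -> S w.

Definition nondecreasing_coord (m : nat) (f : hypercube m -> bool) : Prop :=
  forall v w, leH v w -> (f v <= f w)%O.

Definition e2 (R : comNzRingType) (k : nat) (x : 'I_k -> R) : R :=
  \sum_(i < k) \sum_(j < k | (i < j)%N) x i * x j.

Definition independent (R : realType) d (T : measurableType d)
    (P : probability T R) d' (T' : measurableType d') (I : finType)
    (Y : I -> {RV P >-> T'}) : Prop :=
  forall (J : {set I}) (E : I -> set T'),
    (forall j, measurable (E j)) ->
    (P (\bigcap_(j in [set` J]) (Y j @^-1` E j)) =
     \prod_(j in J) P (Y j @^-1` E j))%E.

Definition FUI (R : realType) (n : nat)
    (mu : probability (hypercube n) R) : Prop :=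
  exists (m : nat) (d : measure_display) (T : measurableType d)
    (P : probability T R) (Y : 'I_m -> {RV P >-> bool})
    (f : 'I_n -> hypercube m -> bool),
  [/\ independent Y,
      forall i, nondecreasing_coord (f i) &
      let X (w : T) : hypercube n := [ffun i => f i [ffun j => Y j w]] in
      forall E : set (hypercube n), mu E = P (X @^-1` E)].

Definition UI (R : realType) (n : nat)
    (mu : probability (hypercube n) R) : Prop :=
  exists nu : nat -> probability (hypercube n) R,
    (forall l, FUI (nu l)) /\
    (forall x : hypercube n, nu l [set x] @[l --> \oo] --> mu [set x]).

(* Main.v *)
(* Call G submodular if G x y + G x' y' <= G x y' + G x' y whenever x <= x' and
   y <= y'.  For i.i.d. x, y with a product law on a hypercube, induction on the
   dimension gives E G(x,x) <= E G(x,y); monotone maps and limits preserve this,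
   so it holds for UI measures.  Order the cells of the partition by
   B < C_i < A, the C_i being pairwise incomparable.  As k >= 2, the hypotheses
   say exactly that the map sending a point to its cell is monotone.  The form
   K on cells with K(A,B) = K(B,A) = 1, K(C_i,C_j) = -1 for i <> j and K = 0
   otherwise is submodular and vanishes on the diagonal, so
   0 <= E K(cell x, cell y) = 2 (mu(A) mu(B) - e2(mu(C_1), ..., mu(C_k))). *)

Require Import Defs.
From mathcomp Require Import all_boot all_order all_algebra.
From mathcomp Require Import all_classical all_reals all_analysis.
From mathcomp Require Import ring lra.

Set Implicit Arguments.
Unset Strict Implicit.
Unset Printing Implicit Defensive.

Import Order.TTheory GRing.Theory Num.Theory.
Import numFieldNormedType.Exports.

Local Open Scope classical_set_scope.
Local Open Scope ring_scope.

(** * Submodular forms under product weights on the hypercube *)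

Definition submodular (R : realType) (T : Type) (le : T -> T -> Prop)
    (G : T -> T -> R) : Prop :=
  forall x x' y y', le x x' -> le y y' ->
    G x y + G x' y' <= G x y' + G x' y.

Definition product_weight (R : realType) (m : nat) (q : 'I_m -> bool -> R)
    (v : hypercube m) : R :=
  \prod_i q i (v i).

Definition hcons (m : nat) (b : bool) (v : hypercube m) : hypercube m.+1 :=
  [ffun i => oapp v b (unlift ord0 i)].

Lemma hcons0 (m : nat) (b : bool) (v : hypercube m) : hcons b v ord0 = b.
Proof. by rewrite ffunE unlift_none. Qed.

Lemma hconsS (m : nat) (b : bool) (v : hypercube m) (i : 'I_m) :
  hcons b v (lift ord0 i) = v i.
Proof. by rewrite ffunE liftK. Qed.

Lemma leH_hcons (m : nat) (b b' : bool) (v v' : hypercube m) :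
  (b <= b')%O -> leH v v' -> leH (hcons b v) (hcons b' v').
Proof.
move=> bb' vv' i.
by case: (unliftP ord0 i) => [j|] ->; rewrite ?hconsS // !hcons0.
Qed.

Lemma leH_refl (m : nat) (v : hypercube m) : leH v v.
Proof. by move=> i. Qed.

Lemma sum_hypercubeS (R : realType) (m : nat) (F : hypercube m.+1 -> R) :
  \sum_v F v = \sum_v F (hcons true v) + \sum_v F (hcons false v).
Proof.
pose h (x : bool * hypercube m) := hcons x.1 x.2.
pose h' (v : hypercube m.+1) : bool * hypercube m :=
  (v ord0, [ffun i => v (lift ord0 i)]).
rewrite (reindex h); last first.
  exists h' => [[b v] _ | v _]; rewrite /h /h' /=.
    by rewrite hcons0; congr pair; apply/ffunP => i; rewrite ffunE hconsS.
  apply/ffunP => i.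
  by case: (unliftP ord0 i) => [j|] ->; rewrite ?hconsS ?hcons0 ?ffunE.
rewrite -(pair_bigA _ (fun b v => F (hcons b v))) /=.
by rewrite big_bool.
Qed.

Lemma product_weight_hcons (R : realType) (m : nat)
    (q : 'I_m.+1 -> bool -> R) (b : bool) (v : hypercube m) :
  product_weight q (hcons b v) =
  q ord0 b * product_weight (fun i => q (lift ord0 i)) v.
Proof.
rewrite /product_weight big_ord_recl hcons0; congr (_ * _).
by apply: eq_bigr => i _; rewrite hconsS.
Qed.

(** Induction on [m], splitting off the first coordinate. Sections of [G] at any first coordinates
    [b], [c] stay submodular, so the induction hypothesis decouples the other coordinates;
    submodularity in the first coordinate then decouples that one. *)
Lemma product_weight_submodular (R : realType) (m : nat)
    (q : 'I_m -> bool -> R) (G : hypercube m -> hypercube m -> R) :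
  (forall i b, 0 <= q i b) -> (forall i, q i true + q i false = 1) ->
  submodular (@leH m) G ->
  \sum_v product_weight q v * G v v <=
  \sum_v \sum_w product_weight q v * product_weight q w * G v w.
Proof.
elim: m q G => [|m IH] q G q_ge0 q_sum1 Gsub.
  have one (F : hypercube 0 -> R) : \sum_v F v = F [ffun=> false].
    rewrite (bigD1 [ffun=> false]) //= big1 ?addr0 // => v /eqP[].
    by apply/ffunP => -[].
  by rewrite !one /product_weight !big_ord0 !mul1r.
set q' := fun i => q (lift ord0 i); set W := product_weight q'.
pose S b c := \sum_v W v * G (hcons b v) (hcons c v).
pose T b c := \sum_v \sum_w W v * W w * G (hcons b v) (hcons c w).
have leST b c : S b c <= T b c.
  apply: (IH q' (fun v w => G (hcons b v) (hcons c w))) => [i a|i|].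
  - exact: q_ge0.
  - exact: q_sum1.
  - by move=> v v' w w' vv' ww'; apply: Gsub; apply: leH_hcons.
(* Submodularity for [hcons false v] below [hcons true v] in both arguments, averaged over [v]. *)
have leS : S true true + S false false <= S true false + S false true.
  rewrite -!big_split /=; apply: ler_sum => v _; rewrite -!mulrDr.
  apply: ler_wpM2l; first by apply: prodr_ge0 => i _; exact: q_ge0.
  by rewrite [leLHS]addrC [leRHS]addrC; apply: Gsub; apply: leH_hcons => //;
    exact: leH_refl.
set p := q ord0 true; set r := q ord0 false.
have diagE b : \sum_v product_weight q (hcons b v) *
    G (hcons b v) (hcons b v) = q ord0 b * S b b.
  rewrite mulr_sumr; apply: eq_bigr => v _.
  by rewrite product_weight_hcons mulrA.
have pairE b c : \sum_v \sum_w product_weight q (hcons b v) *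
    product_weight q (hcons c w) *
    G (hcons b v) (hcons c w) = q ord0 b * q ord0 c * T b c.
  rewrite mulr_sumr; apply: eq_bigr => v _.
  rewrite mulr_sumr; apply: eq_bigr => w _.
  by rewrite !product_weight_hcons -/q' -/W; ring.
rewrite !sum_hypercubeS !diagE.
under [X in _ <= X + _]eq_bigr do rewrite sum_hypercubeS.
under [X in _ <= _ + X]eq_bigr do rewrite sum_hypercubeS.
rewrite !big_split /= !pairE -/p -/r.
have p0 : 0 <= p by exact: q_ge0.
have r0 : 0 <= r by exact: q_ge0.
(* Since [p + r = 1], [p = p * p + p * r] and [r = r * r + p * r]; the [p * r] terms are where [leS]
   enters. *)
have -> : p * S true true + r * S false false =
    p * p * S true true + r * r * S false false +
    p * r * (S true true + S false false).
  have <- : 1 - p = r by rewrite -(q_sum1 ord0) -/p -/r; ring.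
  ring.
have pr0 : 0 <= p * r by exact: mulr_ge0.
have := ler_wpM2l (mulr_ge0 p0 p0) (leST true true).
have := ler_wpM2l (mulr_ge0 r0 r0) (leST false false).
have := ler_wpM2l pr0 (leST true false).
have := ler_wpM2l pr0 (leST false true).
have := ler_wpM2l pr0 leS.
lra.
Qed.

(** * FUI and UI measures through finite sums *)

Lemma fine_measure_preimage (R : realType) (d : measure_display)
    (T : measurableType d) (P : probability T R) (V : finType) (g : T -> V)
    (D : set V) :
  (forall v, measurable (g @^-1` [set v])) ->
  fine (P (g @^-1` D)) = \sum_(v | v \in D) fine (P (g @^-1` [set v])).
Proof.
move=> mg.
have -> : g @^-1` D = \bigcup_(v in D) (g @^-1` [set v]).
  apply/seteqP; split => [x Dx|x [v Dv /= gxv]]; first by exists (g x).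
  by rewrite /preimage /= gxv.
rewrite measure_fin_bigcup //; last by move=> i j _ _ [x [/= <- <-]].
rewrite (fsbigE (enum [pred v | v \in D])) ?enum_uniq //.
- rewrite big_enum_cond sum_fine; last by move=> v _; rewrite fin_num_measure.
  by congr fine; apply: eq_bigl => v; rewrite inE andbb.
- by move=> v /=; rewrite mem_enum !inE.
- by move=> v Dv; rewrite mem_enum inE mem_set.
- exact: finite_finset.
Qed.

Lemma fine_measure_hypercube (R : realType) (n : nat)
    (mu : probability (hypercube n) R) (D : set (hypercube n)) :
  fine (mu D) = \sum_(x | x \in D) fine (mu [set x]).
Proof. exact: (fine_measure_preimage mu (g := id)). Qed.

(** The sample space can be replaced by the cube of values of [Y]: independence makes the law of
    that vector a product weight, and [F] bundles the maps [f i]. *)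
Lemma FUI_product_weight (R : realType) (n : nat)
    (mu : probability (hypercube n) R) : FUI mu ->
  exists m (q : 'I_m -> bool -> R) (F : hypercube m -> hypercube n),
    [/\ forall i b, 0 <= q i b,
        forall i, q i true + q i false = 1,
        forall v w, leH v w -> leH (F v) (F w) &
        forall x, fine (mu [set x]) = \sum_(v | F v == x) product_weight q v].
Proof.
move=> [m [d [T [P [Y [f [indY mono_f muE]]]]]]].
pose q i b := fine (P (Y i @^-1` [set b])).
pose Yv (w : T) : hypercube m := [ffun j => Y j w].
pose F (v : hypercube m) : hypercube n := [ffun i => f i v].
have mY i (E : set bool) : measurable (Y i @^-1` E).
  by rewrite -[X in measurable X]setTI; exact: measurable_funP.
(* A fibre of [Yv] is written as an intersection over all indices, the form to which [independent]
   applies. *)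
have YvE v : Yv @^-1` [set v] =
    \bigcap_(j in [set` [set: 'I_m]%SET]) (Y j @^-1` [set v j]).
  apply/seteqP; split => [w /= <- j _|w Yw] /=; first by rewrite ffunE.
  by apply/ffunP => j; rewrite ffunE; apply: Yw; rewrite /= inE.
have mYv v : measurable (Yv @^-1` [set v]).
  by rewrite YvE; apply: fin_bigcap_measurable => // i _; exact: mY.
have PYv v : fine (P (Yv @^-1` [set v])) = product_weight q v.
  rewrite YvE (indY [set: 'I_m]%SET (fun j => [set v j])) //.
  rewrite (eq_bigr (fun j => (q j (v j))%:E)); last first.
    by move=> j _; rewrite fineK // fin_num_measure.
  rewrite prodEFin /=; by apply: eq_bigl => j; rewrite finset.in_setT.
exists m, q, F; split.
- by move=> i b; exact: fine_ge0.
- move=> i; have := fine_measure_preimage P [set: bool] (fun b => mY i [set b]).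
  rewrite preimage_setT probability_setT /= => ->.
  by rewrite (eq_bigl xpredT) ?big_bool // => b; rewrite in_setT.
- by move=> v w vw i; rewrite !ffunE; exact: mono_f.
- move=> x; rewrite muE.
  have -> : (fun w => [ffun i => f i [ffun j => Y j w]]) @^-1` [set x] =
      Yv @^-1` [set v | F v = x] by [].
  rewrite (fine_measure_preimage _ _ mYv).
  apply: eq_big => [v|v _]; last exact: PYv.
  by apply/idP/eqP => [/set_mem|/mem_set].
Qed.

(** The pullback of [G] along the monotone [F] is again submodular, and sums against [mu] become
    sums against the product weight. *)
Lemma FUI_submodular (R : realType) (n : nat)
    (mu : probability (hypercube n) R)
    (G : hypercube n -> hypercube n -> R) :
  FUI mu -> submodular (@leH n) G ->
  \sum_x fine (mu [set x]) * G x x <=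
  \sum_x \sum_y fine (mu [set x]) * fine (mu [set y]) * G x y.
Proof.
move=> /FUI_product_weight[m [q [F [q0 q1 monoF muE]]]] Gsub.
have pushE (H : hypercube n -> R) :
    \sum_x fine (mu [set x]) * H x = \sum_v product_weight q v * H (F v).
  rewrite (partition_big F xpredT) //=; apply: eq_bigr => x _.
  by rewrite muE mulr_suml; apply: eq_bigr => v /eqP ->.
have -> : \sum_x \sum_y fine (mu [set x]) * fine (mu [set y]) * G x y =
    \sum_v \sum_w product_weight q v * product_weight q w * G (F v) (F w).
  under eq_bigr do (under eq_bigr do rewrite -mulrA; rewrite -mulr_sumr pushE).
  rewrite pushE; apply: eq_bigr => v _; rewrite mulr_sumr.
  by apply: eq_bigr => w _; rewrite mulrA.
rewrite pushE.
apply: (product_weight_submodular (G := fun v w => G (F v) (F w))) => //.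
by move=> v v' w w' vv' ww'; apply: Gsub; exact: monoF.
Qed.

(** Both sides are polynomials in the finitely many point masses, so the weak inequality passes to
    the limit. *)
Lemma UI_submodular (R : realType) (n : nat)
    (mu : probability (hypercube n) R)
    (G : hypercube n -> hypercube n -> R) :
  UI mu -> submodular (@leH n) G ->
  \sum_x fine (mu [set x]) * G x x <=
  \sum_x \sum_y fine (mu [set x]) * fine (mu [set y]) * G x y.
Proof.
move=> [nu [nuF nu_mu]] Gsub.
have cvg_nu x : fine (nu l [set x]) @[l --> \oo] --> fine (mu [set x]).
  by apply: fine_cvg; rewrite fineK ?fin_num_measure.
pose weight l x := fine (nu l [set x]).
have cvg_diag : \sum_x weight l x * G x x @[l --> \oo] -->
    \sum_x fine (mu [set x]) * G x x.
  apply: cvg_big => [|x _]; first exact: add_continuous.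
  by apply: cvgM; [exact: cvg_nu|exact: cvg_cst].
have cvg_pair : \sum_x \sum_y weight l x * weight l y * G x y @[l --> \oo] -->
    \sum_x \sum_y fine (mu [set x]) * fine (mu [set y]) * G x y.
  apply: cvg_big => [|x _]; first exact: add_continuous.
  apply: cvg_big => [|y _]; first exact: add_continuous.
  apply: cvgM; last exact: cvg_cst.
  by apply: cvgM; exact: cvg_nu.
apply: ler_cvg_to cvg_diag cvg_pair _.
by apply: nearW => l; exact: FUI_submodular.
Qed.

(** * The quadratic form on the cells of the partition *)

(* [inr true] stands for A, [inr false] for B and [inl i] for C i. *)
Definition cell_le (k : nat) (c c' : 'I_k + bool) : bool :=
  match c, c' with
  | inr false, _ | _, inr true => true
  | inl i, inl j => i == j
  | _, _ => false
  end.

Definition cell_form (R : realType) (k : nat) (c c' : 'I_k + bool) : R :=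
  match c, c' with
  | inr true, inr false | inr false, inr true => 1
  | inl i, inl j => - (i != j)%:R
  | _, _ => 0
  end.

(** Writing K for the form, K(C_i,.) - K(B,.) is 0 at B and C_i and -1 elsewhere, while K(A,.) -
    K(C_i,.) is 0 at C_i and A and 1 elsewhere. Both differences are nonincreasing, which is
    submodularity; the proof checks it by cases. *)
Lemma cell_form_submodular (R : realType) (k : nat) :
  submodular (@cell_le k) (@cell_form R k).
Proof.
move=> [i|[]] [i'|[]] [j|[]] [j'|[]] //= => h h'; try lra.
all: try move/eqP: h => <-; try move/eqP: h' => <-; try lra.
(* What remains only needs the indicator of [i != j] to lie between 0 and 1. *)
all: by case: (_ != _) => /=; rewrite ?mulr0n ?mulr1n; lra.
Qed.

(** The two triangles off the diagonal contribute [e2 c] each. *)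
Lemma sum_neq_e2 (R : comNzRingType) (k : nat) (c : 'I_k -> R) :
  \sum_i \sum_j c i * c j * (i != j)%:R = e2 c *+ 2.
Proof.
have lowerE : \sum_(i < k) \sum_(j < k | (j < i)%N) c i * c j = e2 c.
  rewrite /e2 (exchange_big_dep xpredT) //=.
  by apply: eq_bigr => i _; apply: eq_bigr => j _; rewrite mulrC.
rewrite mulr2n -{2}lowerE /e2 -big_split /=; apply: eq_bigr => i _.
rewrite [X in X + _]big_mkcond [X in _ + X]big_mkcond -big_split /=.
apply: eq_bigr => j _; rewrite -val_eqE /=.
by case: ltngtP => _; rewrite ?mulr1 ?mulr0 ?addr0 ?add0r.
Qed.

Lemma sum_cell_form (R : realType) (k : nat) (M : 'I_k + bool -> R) :
  \sum_c \sum_c' M c * M c' * cell_form R c c' =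
  (M (inr true) * M (inr false) - e2 (fun i => M (inl i))) *+ 2.
Proof.
have sum_inl : \sum_(i < k) \sum_c' M (inl i) * M c' * cell_form R (inl i) c' =
    - e2 (fun i => M (inl i)) *+ 2.
  rewrite mulNrn -sum_neq_e2 -sumrN; apply: eq_bigr => i _.
  rewrite big_sumType big_bool /= !mulr0 !addr0 -sumrN.
  by apply: eq_bigr => j _; rewrite mulrN.
rewrite big_sumType big_bool sum_inl !big_sumType !big_bool /=.
rewrite !big1 => [|*|*]; rewrite ?mulr0 //.
by ring.
Qed.

Theorem theorem3p2 (R : realType) (n k : nat) (hk : (2 <= k)%N)
    (mu : probability (hypercube n) R) (hmu : UI mu)
    (A B : set (hypercube n)) (C : 'I_k -> set (hypercube n))
    (hAB : A `&` B = set0)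
    (hAC : forall i, A `&` C i = set0)
    (hBC : forall i, B `&` C i = set0)
    (hCC : forall i j, i != j -> C i `&` C j = set0)
    (hcover : A `|` (\bigcup_(i in [set: 'I_k]) C i) `|` B = [set: hypercube n])
    (hup : forall i, closed_upwards (A `|` C i)) :
  fine (mu A) * fine (mu B) >= e2 (fun i => fine (mu (C i))).
Proof.
pose cell (c : 'I_k + bool) : set (hypercube n) :=
  match c with inr true => A | inr false => B | inl i => C i end.
have disj (S S' : set (hypercube n)) x :
    S `&` S' = set0 -> S x -> S' x -> False.
  by move=> SS' Sx S'x; rewrite -[False]/(set0 x) -SS'.
have cell_inj c c' x : cell c x -> cell c' x -> c = c'.
  case: c c' => [i|[]] [j|[]] //= cx c'x.
  - by case: (eqVneq i j) => [->//|/hCC/disj/(_ cx c'x)].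
  - by case: (disj _ _ x (hAC i)).
  - by case: (disj _ _ x (hBC i)).
  - by case: (disj _ _ x (hAC j)).
  - by case: (disj _ _ x hAB).
  - by case: (disj _ _ x (hBC j)).
  - by case: (disj _ _ x hAB).
have /choice[lab labP] x : exists c, cell c x.
  have : [set: hypercube n] x by [].
  rewrite -hcover => -[[Ax|[i _ Cx]]|Bx].
  - by exists (inr true).
  - by exists (inl i).
  - by exists (inr false).
have labE c x : cell c x -> lab x = c by exact: cell_inj.
have lab_mono x y : leH x y -> cell_le (lab x) (lab y).
  move=> xy.
  have labAC i : (A `|` C i) x -> lab y = inr true \/ lab y = inl i.
    move=> /(hup i) /(_ xy)[Ay|Cy]; first by left; exact: labE.
    by right; exact: labE.
  move: (labP x); case: (lab x) => [i|[]] //= cx.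
    by have [->|->] := labAC i (or_intror cx).
  (* For [x] in [A], two distinct indices 0 and 1 are used: [y] lies in both [A ∪ C 0] and
     [A ∪ C 1], whose intersection is [A] by disjointness. *)
  have [-> //|lab0] := labAC (Ordinal (ltnW hk)) (or_introl cx).
  have [-> //|] := labAC (Ordinal hk) (or_introl cx).
  by rewrite lab0 => -[].
(* [M] is the image of [mu] under [lab]; it turns sums over the cube into sums over cells. *)
pose M c := \sum_(x | lab x == c) fine (mu [set x]).
have ME c : fine (mu (cell c)) = M c.
  rewrite fine_measure_hypercube; apply: eq_bigl => x.
  by apply/idP/eqP => [/set_mem/labE|<-]; [|exact/mem_set].
have sumM (H : 'I_k + bool -> R) :
    \sum_x fine (mu [set x]) * H (lab x) = \sum_c M c * H c.
  rewrite (partition_big lab xpredT) //=; apply: eq_bigr => c _.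
  by rewrite mulr_suml; apply: eq_bigr => x /eqP ->.
have Gsub : submodular (@leH n) (fun x y => cell_form R (lab x) (lab y)).
  move=> x x' y y' xx' yy'.
  by apply: cell_form_submodular; exact: lab_mono.
have := UI_submodular hmu Gsub.
(* The form vanishes on the diagonal, so the left side is 0. *)
rewrite big1 => [|x _]; last first.
  by case: (lab x) => [i|[]] /=; rewrite ?eqxx ?oppr0 mulr0.
have -> : \sum_x \sum_y fine (mu [set x]) * fine (mu [set y]) *
    cell_form R (lab x) (lab y) = \sum_c \sum_c' M c * M c' * cell_form R c c'.
  under eq_bigr do (under eq_bigr do rewrite -mulrA; rewrite -mulr_sumr sumM).
  rewrite (sumM (fun c => \sum_c' M c' * cell_form R c c')).
  apply: eq_bigr => c _; rewrite mulr_sumr.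
  by apply: eq_bigr => c' _; rewrite mulrA.
rewrite sum_cell_form pmulrn_lge0 // subr_ge0.
rewrite -(ME (inr true)) -(ME (inr false)) /e2.
by under eq_bigr do under eq_bigr do rewrite -!ME.
Qed.
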